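(* Let $r\in R$ be a retailer and $l\in\{3,\ldots,|T|\}$. Let $L^0=\{1,\ldots,l_0\}$ with $1\le l_0<l-1$, and $S^0\subseteq L^0$. Let $L^1=\{l_0+1,\ldots,l_1\}$ with $l_0+1\le l_1<l$, and $S^1\subseteq L^1$. Let $L^2=\{l_1+1,\ldots,l\}$ and $S^2\subseteq L^2$. Then the three-level inequality $$\sum_{k\in L^0\setminus S^0}x^{0r}_k+\sum_{k\in S^0}d^r_{kl}\,y^p_k+\sum_{k\in L^1\setminus S^1}x^{1r}_k+\sum_{k\in S^1}d^r_{kl}\,y^{\delta_w(r)}_k+\sum_{k\in L^2\setminus S^2}x^{2r}_k+\sum_{k\in S^2}d^r_{kl}\,y^r_k\ \ge\ d^r_{1l}$$ is valid for $X^{3LF}$, i.e. it is satisfied by every element of $X^{3LF}$.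
   Context: Problem data (uncapacitated three-level lot-sizing and replenishment problem with a distribution structure). $T=\{1,\ldots,|T|\}$ is a finite set of consecutive periods. $F=P\cup W\cup R$ is a finite set of facilities (disjoint union), with $P=\{p\}$ (plant, level 0), $W$ the warehouses (level 1), $R$ the retailers (level 2). Each retailer $r\in R$ has a unique warehouse $\delta_w(r)\in W$. Each retailer $r$ has demands $d^r_t\ge 0$, $t\in T$, and $d^r_{kt}=\sum_{l=k}^{t}d^r_l$ for $1\le k\le t\le |T|$. $X^{3LF}$ is the set of all $(x^0,x^1,x^2,s^0,s^1,s^2,y)$, with $x^b=(x^{br}_t)$, $s^b=(s^{br}_t)$ indexed by $r\in R$, $t\in T$ ($b\in\{0,1,2\}$), and $y=(y^i_t)$ indexed by $i\in F$, $t\in T$, with the convention $s^{br}_0=0$, satisfying for all $r\in R$, $t\in T$: - $s^{0r}_{t-1}+x^{0r}_t=x^{1r}_t+s^{0r}_t$; - $s^{1r}_{t-1}+x^{1r}_t=x^{2r}_t+s^{1r}_t$; - $s^{2r}_{t-1}+x^{2r}_t=d^r_t+s^{2r}_t$; - $x^{0r}_t\le d^r_{t|T|}y^p_t$, $\ x^{1r}_t\le d^r_{t|T|}y^{\delta_w(r)}_t$, $\ x^{2r}_t\le d^r_{t|T|}y^r_t$; - $x^{0r}_t,x^{1r}_t,x^{2r}_t,s^{0r}_t,s^{1r}_t,s^{2r}_t\ge 0$; and $y^i_t\in\{0,1\}$ for all $i\in F$, $t\in T$. *)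

(* Defs.v *)
From mathcomp Require Import all_boot all_order all_algebra.
Set Implicit Arguments.
Unset Strict Implicit.
Unset Printing Implicit Defensive.
Import Order.TTheory GRing.Theory Num.Theory.
Local Open Scope ring_scope.

(* Plain MathComp, over an arbitrary real field K. *)

(* The set of periods is {1, ..., horizon}. Time-indexed families are functions
   on nat; only their values at periods (and at 0 for the stocks, where they
   are required to vanish) are ever constrained or used. *)
Record lotsizing (K : realFieldType) := LotSizing {
  horizon : nat;
  warehouse : finType;
  retailer : finType;
  delta_w : retailer -> warehouse;
  demand : retailer -> nat -> K;
  demand_ge0 : forall r t, (1 <= t <= horizon)%N -> 0 <= demand r t
}.

(* F is the disjoint union of P = {p}, W and R. *)
Inductive facility (K : realFieldType) (I : lotsizing K) : Type :=
  | Plant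
  | Warehouse of warehouse I
  | Retailer of retailer I.

Arguments Plant {K I}.
Arguments Warehouse {K I}.
Arguments Retailer {K I}.

(* d^r_{kt} = d^r_k + ... + d^r_t *)
Definition cumdemand (K : realFieldType) (I : lotsizing K)
    (r : retailer I) (k t : nat) : K :=
  \sum_(k <= j < t.+1) demand r j.

Record plan (K : realFieldType) (I : lotsizing K) := Plan {
  x0 : retailer I -> nat -> K;
  x1 : retailer I -> nat -> K;
  x2 : retailer I -> nat -> K;
  s0 : retailer I -> nat -> K;
  s1 : retailer I -> nat -> K;
  s2 : retailer I -> nat -> K;
  y : facility I -> nat -> K
}.

Definition X3LF (K : realFieldType) (I : lotsizing K) (v : plan I) : Prop :=
  let T := horizon I in
  [/\ forall r : retailer I, [/\ s0 v r 0%N = 0, s1 v r 0%N = 0 & s2 v r 0%N = 0],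
      forall (r : retailer I) (t : nat), (1 <= t <= T)%N ->
        [/\ s0 v r t.-1 + x0 v r t = x1 v r t + s0 v r t,
            s1 v r t.-1 + x1 v r t = x2 v r t + s1 v r t &
            s2 v r t.-1 + x2 v r t = demand r t + s2 v r t],
      forall (r : retailer I) (t : nat), (1 <= t <= T)%N ->
        [/\ x0 v r t <= cumdemand r t T * y v Plant t,
            x1 v r t <= cumdemand r t T * y v (Warehouse (delta_w r)) t &
            x2 v r t <= cumdemand r t T * y v (Retailer r) t],
      forall (r : retailer I) (t : nat), (1 <= t <= T)%N ->
        [/\ 0 <= x0 v r t, 0 <= x1 v r t & 0 <= x2 v r t] /\
        [/\ 0 <= s0 v r t, 0 <= s1 v r t & 0 <= s2 v r t] &
      forall (i : facility I) (t : nat), (1 <= t <= T)%N ->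
        y v i t = 0 \/ y v i t = 1].

(* {a, ..., b} as a set of numbers at most n; it is a set of periods of a
   problem with horizon n when 1 <= a. *)
Definition periods (n a b : nat) : {set 'I_n.+1} :=
  [set k : 'I_n.+1 | (a <= k <= b)%N].

(* Main.v *)
(* Adding the left-hand side up period by period, every partial sum is at least
   the minimum of d_{1l} and the quantity shipped so far at the current level b.
   A period k of S with y_k = 1 contributes d_{kl}, which completes the at least
   d_{1,k-1} units already shipped to d_{1l}; a period of S with y_k = 0 ships
   nothing.  Passing from level b to level b + 1 keeps the invariant, since stocks
   are nonnegative. *)
Require Import Defs.
From mathcomp Require Import all_boot all_order all_algebra.
From mathcomp Require Import zify lra.
Set Implicit Arguments.
Unset Strict Implicit.
Unset Printing Implicit Defensive.
Import Order.TTheory GRing.Theory Num.Theory.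
Local Open Scope ring_scope.

(** Merges the two sums of one level into a sum over consecutive natural numbers, on which induction
    over periods is possible. Since [b <= n], every [inord k] in the range really denotes [k] and
    not the default ordinal. *)
Lemma sum_periods (V : nmodType) (n a b : nat) (S : {set 'I_n.+1})
    (F G : nat -> V) :
  (b <= n)%N -> S \subset periods n a b ->
  \sum_(k in periods n a b :\: S) F k + \sum_(k in S) G k =
  \sum_(a <= k < b.+1) (if inord k \in S then G k else F k).
Proof.
move=> le_bn /setIidPr sSL.
rewrite big_geq_mkord (big_ord_widen_cond n.+1 (fun k => a <= k)%N
  (fun k => if inord k \in S then G k else F k)) ?ltnS //=.
rewrite [RHS](eq_bigl (fun k : 'I_n.+1 => k \in periods n a b));
  last by move=> k; rewrite inE.
rewrite [RHS](big_setID S) /= sSL addrC; congr (_ + _); apply: eq_bigr => k.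
  by rewrite inE inord_val => /andP[/negPf-> _].
by rewrite inord_val => ->.
Qed.

(** The balances telescope, starting from an empty stock. *)
Lemma sum_stock_balance (K : realFieldType) (u w s : nat -> K) (T t : nat) :
  s 0%N = 0 ->
  (forall k, (1 <= k <= T)%N -> s k.-1 + u k = w k + s k) -> (t <= T)%N ->
  \sum_(1 <= k < t.+1) u k = \sum_(1 <= k < t.+1) w k + s t.
Proof.
move=> s00 bal; elim: t => [|t IHt] le_tT.
  by rewrite !big_geq // s00 addr0.
rewrite !(big_nat_recr t.+1) //= IHt 1?ltnW //.
by rewrite -!addrA (bal t.+1).
Qed.

(** The gap between the two totals is the stock at [t]. Used at each level, this gives the chain
    from demand up through levels 2, 1 and 0. *)
Lemma sum_outflow_le_inflow (K : realFieldType) (u w s : nat -> K) (T t : nat) :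
  s 0%N = 0 ->
  (forall k, (1 <= k <= T)%N -> s k.-1 + u k = w k + s k) ->
  (forall k, (1 <= k <= T)%N -> 0 <= s k) -> (t <= T)%N ->
  \sum_(1 <= k < t.+1) w k <= \sum_(1 <= k < t.+1) u k.
Proof.
move=> s00 bal s_ge0 le_tT; rewrite (sum_stock_balance s00 bal le_tT) lerDl.
(* [s_ge0] only covers periods from 1 on; at [t = 0] the initial condition takes over. *)
by case: t le_tT => [|t] lt_tT; rewrite ?s00 ?s_ge0.
Qed.

(** Induction on [e] carries the invariant through one level: [C] stands for the contribution of the
    earlier levels, which stop at period [a], and [setup] for membership in the set chosen at this
    level. *)
Lemma level_bound (K : realFieldType) (d x M y : nat -> K) (setup : pred nat)
    (T l a e : nat) (C : K) :
  (forall k, (1 <= k <= T)%N -> 0 <= d k) ->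
  (forall k, (1 <= k <= T)%N -> 0 <= x k) ->
  (forall k, (1 <= k <= T)%N -> x k <= M k * y k) ->
  (forall k, (1 <= k <= T)%N -> y k = 0 \/ y k = 1) ->
  (forall t, (t <= T)%N ->
     \sum_(1 <= k < t.+1) d k <= \sum_(1 <= k < t.+1) x k) ->
  (l <= T)%N -> (a <= e <= l)%N ->
  Num.min (\sum_(1 <= k < l.+1) d k) (\sum_(1 <= k < a.+1) x k) <= C ->
  Num.min (\sum_(1 <= k < l.+1) d k) (\sum_(1 <= k < e.+1) x k) <=
  C + \sum_(a.+1 <= k < e.+1)
        (if setup k then (\sum_(k <= j < l.+1) d j) * y k else x k).
Proof.
move=> d_ge0 x_ge0 x_le y01 d_le_x le_lT /andP[+ +] C_ge.
elim: e => [|e IHe] le_ae le_el.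
  have a0 : a = 0%N by lia.
  by rewrite a0 in C_ge *; rewrite [X in C + X]big_geq // addr0.
have [eq_ae|lt_ae] := eqVneq a e.+1; first by rewrite -eq_ae [X in C + X]big_geq // addr0.
rewrite (big_nat_recr e.+1 a.+1) /=; last by lia.
have {IHe} := IHe ltac:(lia) ltac:(lia).
set B := \sum_(a.+1 <= k < e.+1) _ => IHe.
rewrite (big_nat_recr e.+1 _ x) //= addrA.
have eT : (1 <= e.+1 <= T)%N by lia.
have xe := x_ge0 _ eT; have xe_le := x_le _ eT.
have := d_le_x e ltac:(lia).
move: IHe.
have -> : \sum_(1 <= k < l.+1) d k =
          \sum_(1 <= k < e.+1) d k + \sum_(e.+1 <= k < l.+1) d k.
  by rewrite -big_cat_nat //; lia.
have rest_ge0 : 0 <= \sum_(e.+1 <= k < l.+1) d k.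
  by rewrite big_nat_cond sumr_ge0 // => k /andP[? _]; apply: d_ge0; lia.
rewrite !ge_min => /orP IHe dx; apply/orP.
(* Outside [setup], both sides of the alternative on shipments gain [x e.+1], and the alternative on
   demand survives because [x e.+1] is nonnegative. *)
case: ifP => _; last by case: IHe => IHe; [left|right]; lra.
(* If [y e.+1 = 0], the capacity bound becomes [x e.+1 <= 0], so the quantity shipped does not
   grow. *)
case: (y01 _ eT) xe_le => ->; rewrite ?mulr0 ?mulr1 => xe_le.
  by case: IHe => IHe; [left|right]; lra.
(* If [y e.+1 = 1], the full demand is reached: either it already was, or [dx] shows that the demand
   before [e.+1] is covered and the new term supplies the rest. *)
by left; case: IHe => IHe; lra.
Qed.

Theorem proposition6 (K : realFieldType) (I : lotsizing K) (r : retailer I)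
  (l l0 l1 : nat) (L0 L1 L2 S0 S1 S2 : {set 'I_(horizon I).+1})
  (hl : (3 <= l <= horizon I)%N)
  (hl0 : (1 <= l0 < l - 1)%N)
  (hL0 : L0 = periods (horizon I) 1 l0)
  (hS0 : S0 \subset L0)
  (hl1 : (l0 + 1 <= l1 < l)%N)
  (hL1 : L1 = periods (horizon I) (l0 + 1) l1)
  (hS1 : S1 \subset L1)
  (hL2 : L2 = periods (horizon I) (l1 + 1) l)
  (hS2 : S2 \subset L2) :
  forall v : plan I, X3LF v ->
    \sum_(k in L0 :\: S0) x0 v r k
    + \sum_(k in S0) cumdemand r k l * y v Plant k
    + \sum_(k in L1 :\: S1) x1 v r k
    + \sum_(k in S1) cumdemand r k l * y v (Warehouse (delta_w r)) k
    + \sum_(k in L2 :\: S2) x2 v r k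
    + \sum_(k in S2) cumdemand r k l * y v (Retailer r) k
    >= cumdemand r 1 l.
Proof.
move=> v [s_init balance capacity nonneg y01]; subst L0 L1 L2.
set T := horizon I in hl capacity balance nonneg y01 S0 S1 S2 hS0 hS1 hS2 *.
have [s00 s10 s20] := s_init r.
pose X (x : nat -> K) t := \sum_(1 <= k < t.+1) x k.
have X01 t : (t <= T)%N -> X (x1 v r) t <= X (x0 v r) t.
  apply: (sum_outflow_le_inflow s00) => k.
    by move=> /(balance r)[].
  by move=> /(nonneg r)[_ []].
have X12 t : (t <= T)%N -> X (x2 v r) t <= X (x1 v r) t.
  apply: (sum_outflow_le_inflow s10) => k.
    by move=> /(balance r)[].
  by move=> /(nonneg r)[_ []].
have Xd2 t : (t <= T)%N -> X (demand r) t <= X (x2 v r) t.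
  apply: (sum_outflow_le_inflow s20) => k.
    by move=> /(balance r)[].
  by move=> /(nonneg r)[_ []].
have Xd1 t : (t <= T)%N -> X (demand r) t <= X (x1 v r) t.
  by move=> le_tT; apply: le_trans (Xd2 t le_tT) (X12 t le_tT).
have Xd0 t : (t <= T)%N -> X (demand r) t <= X (x0 v r) t.
  by move=> le_tT; apply: le_trans (Xd1 t le_tT) (X01 t le_tT).
have d_ge0 k : (1 <= k <= T)%N -> 0 <= demand r k by apply: demand_ge0.
have le_lT : (l <= T)%N by lia.
(* Groups the six sums into one pair per level. *)
rewrite -[leRHS]addrA -[X in _ <= X + _]addrA.
rewrite (sum_periods (x0 v r) (fun k => cumdemand r k l * y v Plant k)
  _ hS0); last by rewrite -/T; lia.
rewrite (sum_periods (x1 v r)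
  (fun k => cumdemand r k l * y v (Warehouse (delta_w r)) k) _ hS1); last by rewrite -/T; lia.
rewrite (sum_periods (x2 v r)
  (fun k => cumdemand r k l * y v (Retailer r) k) _ hS2); last by rewrite -/T; lia.
rewrite !addn1 /cumdemand.
(* At the final period, the demand is the smaller argument of the minimum. The levels are then
   peeled off backwards, from 2 to 0. *)
rewrite -[leLHS](min_l (Xd2 l le_lT)).
apply: (level_bound (M := fun k => cumdemand r k T)
  (fun k => inord k \in S2) d_ge0 _ _ (y01 _) Xd2 le_lT).
- by move=> k /(nonneg r)[[]].
- by move=> k /(capacity r)[].
- by lia.
(* Change of level at period [l1]: replacing level 2 shipments by the larger level 1 shipments can
   only raise the minimum. *)
apply: (le_trans (y := Num.min (X (demand r) l) (X (x1 v r) l1))).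
  by rewrite le_min2 // X12 //; lia.
apply: (level_bound (M := fun k => cumdemand r k T)
  (fun k => inord k \in S1) d_ge0 _ _ (y01 _) Xd1 le_lT).
- by move=> k /(nonneg r)[[]].
- by move=> k /(capacity r)[].
- by lia.
apply: (le_trans (y := Num.min (X (demand r) l) (X (x0 v r) l0))).
  by rewrite le_min2 // X01 //; lia.
(* Level 0 starts with [C = 0] and [a = 0], where the quantity shipped is an empty sum and the
   minimum is at most 0. *)
rewrite -[leRHS]add0r.
apply: (level_bound (M := fun k => cumdemand r k T)
  (fun k => inord k \in S0) d_ge0 _ _ (y01 _) Xd0 le_lT).
- by move=> k /(nonneg r)[[]].
- by move=> k /(capacity r)[].
- by lia.
by rewrite [X in Num.min _ X]big_geq // ge_min lexx orbT.
Qed.
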